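(* Let $(\mathcal F,\preceq)$ be an intersection system on the finite set $N$ and let $v:\mathcal F\to\mathbb R_+$ be a supermodular capacity on $(\mathcal F,\preceq)$. Then for all $f\in\mathbb R^N_+$, $$\int_{\mathcal F} f\,dv=\max\Big\{\sum_{F\in\mathcal F}y_Fv(F)\;\Big|\; y\in\mathbb R^{\mathcal F}_+,\ \sum_{F\in\mathcal F}y_F\mathbf 1_F\le f\Big\}.$$ Hence $f\mapsto\int_{\mathcal F} f\,dv$ is a positively homogeneous and superadditive functional on $\mathbb R^N_+$.
   Context: An ordered system is a pair $(\mathcal F,\preceq)$ with $\mathcal F$ a family of non-empty subsets of a finite set $N$ covering $N$ and $\preceq$ a partial order on $\mathcal F$; index $\mathcal F=\{F_1,\dots,F_m\}$ so that $F_i\succeq F_j$ implies $i\le j$. For $X\subseteq N$ let $\mathcal F(X)=\{F\in\mathcal F\mid F\subseteq X\}$ and $\mathcal F_0(X)=\mathcal F(X)\cup\{\emptyset\}$. The system is consecutive if $F\cap H\subseteq G$ whenever $F\preceq G\preceq H$. A consecutive ordered system is an intersection system if for every $F\in\mathcal F$: (IS0) for every $G\in\mathcal F$ with $F\cap G\ne\emptyset$ there is some $F\vee G\in\mathcal F(F\cup G)$ with $F,G\preceq F\vee G$; (IS1) for all $G,H\in[F)=\{G\in\mathcal F\mid G\succeq F\}$ there exist $G\vee H,G\wedge H\in\mathcal F(G\cup H)$ with $F\preceq G\wedge H\preceq G,H\preceq G\vee H$. A capacity is a valuation $v:\mathcal F\to\mathbb R_+$ with $v(F)\le v(G)$ whenever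 $F\preceq G$. Extend $\preceq$ to $\mathcal F\cup\{\emptyset\}$ with $\emptyset$ the unique minimum, and set $v(\emptyset)=0$. $F_i,F_j$ are co-intersecting if there is $k\le\min\{i,j\}$ with $F_k\cap F_i\ne\emptyset$ and $F_k\cap F_j\ne\emptyset$. $v$ is supermodular if for all co-intersecting $F,G\in\mathcal F$ there exist $F\wedge G,F\vee G\in\mathcal F_0(F\cup G)$ with $F\wedge G\preceq F,G\preceq F\vee G$ and $v(F\wedge G)+v(F\vee G)\ge v(F)+v(G)$. Simple functions: for $F\in\mathcal F$, $\zeta^F(G)=1$ iff $G\succeq F$, else $0$; each valuation has a unique expansion $v=\sum_F\beta_F\zeta^F$. For a belief function ($\beta_F\ge0$ for all $F$) and $f\in\mathbb R^N_+$: $\int_{\mathcal F} f\,dv:=\min\{\langle f,x\rangle\mid x\in\mathbb R^N_+,\ x(G)\ge v(G)\ \forall G\in\mathcal F\}$ with $x(G)=\sum_{i\in G}x_i$; for general $v$, $\int_{\mathcal F} f\,dv:=\int_{\mathcal F} f\,dv^+-\int_{\mathcal F} f\,dv^-$ where $v^+=\sum_{\beta_F\ge0}\beta_F\zeta^F$, $v^-=\sum_{\beta_F\le0}(-\beta_F)\zeta^F$. *)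

(* Defs.v *)
From mathcomp Require Import boolp classical_sets reals.
From mathcomp Require Import all_boot all_order all_algebra.

Set Implicit Arguments.
Unset Strict Implicit.
Unset Printing Implicit Defensive.

Import Order.TTheory GRing.Theory Num.Theory.

Local Open Scope ring_scope.

(* [sys_le] is only meaningful on [family]; its values elsewhere are never
   used. *)
Record ordered_system (N : finType) := OrderedSystem {
  family :> {set {set N}};
  sys_le : rel {set N};
  family_set0 : set0 \notin family;
  family_cover : cover family = [set: N];
  sys_le_refl : {in family, reflexive sys_le};
  sys_le_anti : {in family &, antisymmetric sys_le};
  sys_le_trans : {in family & &, transitive sys_le} }.

Section OrderedSystem.
Variables (N : finType) (S : ordered_system N).
Implicit Types (F G H K X : {set N}).

Local Notation "F ⪯ G" := (sys_le S F G) (at level 70).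

(* F_1, ..., F_m is the sequence [e]; larger members come first. *)
Definition is_indexing (e : seq {set N}) : Prop :=
  [/\ uniq e, e =i (S : {set {set N}}) &
      {in S &, forall F G, G ⪯ F -> (index F e <= index G e)%N}].

Definition consecutive : Prop :=
  forall F G H, F \in S -> G \in S -> H \in S ->
    F ⪯ G -> G ⪯ H -> F :&: H \subset G.

Definition members X : {set {set N}} := [set F in S | F \subset X].

Definition members0 X : {set {set N}} := set0 |: members X.

Definition IS0 F : Prop :=
  forall G, G \in S -> F :&: G != set0 ->
    exists J, [/\ J \in members (F :|: G), F ⪯ J & G ⪯ J].

Definition IS1 F : Prop :=
  forall G H, G \in S -> H \in S -> F ⪯ G -> F ⪯ H ->
    exists J M,
      [/\ J \in members (G :|: H), M \in members (G :|: H), F ⪯ M,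
          M ⪯ G /\ M ⪯ H & G ⪯ J /\ H ⪯ J].

Definition intersection_system : Prop :=
  consecutive /\ (forall F, F \in S -> IS0 F /\ IS1 F).

(* The order extended to [family] plus the empty set. *)
Definition sys_le0 F G : bool :=
  (F == set0) || [&& F \in S, G \in S & F ⪯ G].

Definition co_intersecting (e : seq {set N}) F G : Prop :=
  exists K, [/\ K \in S, (index K e <= minn (index F e) (index G e))%N,
                K :&: F != set0 & K :&: G != set0].

Variable R : realType.
(* A valuation is a function on [{set N}] of which only the values on [family]
   matter; the same convention holds for coefficient vectors indexed by the
   family. *)
Implicit Types (v b y : {set N} -> R) (f x : N -> R).

Definition capacity v : Prop :=
  (forall F, F \in S -> 0 <= v F) /\
  (forall F G, F \in S -> G \in S -> F ⪯ G -> v F <= v G).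

Definition val0 v F : R := if F == set0 then 0 else v F.

Definition supermodular (e : seq {set N}) v : Prop :=
  forall F G, F \in S -> G \in S -> co_intersecting e F G ->
    exists M J,
      [/\ M \in members0 (F :|: G), J \in members0 (F :|: G),
          sys_le0 M F /\ sys_le0 M G, sys_le0 F J /\ sys_le0 G J &
          v F + v G <= val0 v M + val0 v J].

Definition simple_fun F G : R := (F ⪯ G)%:R.

Definition is_expansion v b : Prop :=
  forall G, G \in S -> v G = \sum_(F in S) b F * simple_fun F G.

(* The expansion exists and is unique on [family]: see [expansion_exists] and
   [expansion_unique] below. *)
Definition coefs v : {set N} -> R :=
  xget (fun=> 0) [set b | is_expansion v b]%classic.

Definition pos_part v G : R :=
  \sum_(F in S | 0 <= coefs v F) coefs v F * simple_fun F G.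

Definition neg_part v G : R :=
  \sum_(F in S | coefs v F <= 0) (- coefs v F) * simple_fun F G.

Definition is_min (A : set R) (r : R) : Prop := A r /\ lbound A r.
Definition is_max (A : set R) (r : R) : Prop := A r /\ ubound A r.

Definition covering_values v f : set R :=
  [set r | exists x, [/\ forall i, 0 <= x i,
                         forall G, G \in S -> v G <= \sum_(i in G) x i &
                         r = \sum_i f i * x i]]%classic.

(* The minimum of [covering_values v f]. For f >= 0 it is attained: the linear
   program is feasible, as the members are non-empty, and bounded below by 0.
   The default 0 of [xget] is only reached when there is no minimum. *)
Definition belief_integral v f : R :=
  xget 0 [set r | is_min (covering_values v f) r]%classic.

Definition integral v f : R :=
  belief_integral (pos_part v) f - belief_integral (neg_part v) f.

Definition packing_values v f : set R :=
  [set r | exists y, [/\ forall F, F \in S -> 0 <= y F,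
                         forall i, \sum_(F in S) y F * (i \in F)%:R <= f i &
                         r = \sum_(F in S) y F * v F]]%classic.

Let below G := [set F in S | F ⪯ G & F != G].

Let below_lt F G : F \in S -> G \in S -> F \in below G ->
  (#|below F| < #|below G|)%N.
Proof.
move=> FS GS FG; apply: proper_card; apply/properP; split.
  apply/subsetP => K; rewrite !inE => /and3P[KS KF nKF].
  move: FG; rewrite !inE => /and3P[_ leFG nFG].
  rewrite KS (sys_le_trans FS KS GS KF leFG) /=.
  apply: contraNneq nKF => KG; apply/eqP.
  by apply: (sys_le_anti KS FS); rewrite KF KG leFG.
exists F; first exact: FG.
by rewrite !inE eqxx !andbF.
Qed.

Let expansionE b G : G \in S ->
  \sum_(F in S) b F * simple_fun F G = b G + \sum_(F in below G) b F.
Proof.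
move=> GS; rewrite (bigD1 G) //= /simple_fun (sys_le_refl GS) mulr1.
congr (_ + _).
rewrite [RHS](eq_bigl (fun F => ((F \in S) && (F != G)) && (F ⪯ G))).
  rewrite [RHS]big_mkcondr /=; apply: eq_bigr => F _.
  by case: ifP; rewrite ?mulr1 ?mulr0.
by move=> F; rewrite !inE andbAC -andbA.
Qed.

Lemma expansion_unique v b b' :
  is_expansion v b -> is_expansion v b' -> {in S, b =1 b'}.
Proof.
move=> vb vb' G; have [n] := ubnP #|below G|; elim: n G => // n IH G ltn GS.
have := vb G GS; rewrite (vb' G GS) !expansionE // => /eqP.
rewrite (eq_bigr b); first by rewrite -subr_eq addrK => /eqP.
move=> F FG; have FS : F \in S by move: FG; rewrite inE => /andP[].
by rewrite IH // (leq_trans (below_lt FS GS FG)).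
Qed.

Lemma expansion_exists v : exists b, is_expansion v b.
Proof.
pose mob := fix mob (n : nat) G {struct n} : R :=
  if n is k.+1 then v G - \sum_(F in below G) mob k F else 0.
have mobE n m G : G \in S -> (#|below G| < n)%N -> (#|below G| < m)%N ->
    mob n G = mob m G.
  elim: n m G => // n IH [//|m] G GS ltn ltm /=; congr (_ - _).
  apply: eq_bigr => F FG; have FS : F \in S by move: FG; rewrite inE => /andP[].
  by have ltFG := below_lt FS GS FG; apply: IH => //; exact: leq_trans ltFG _.
exists (fun G => mob #|below G|.+1 G) => G GS; rewrite expansionE //.
rewrite [X in _ + X](_ : _ = \sum_(F in below G) mob #|below G| F) ?subrK //.
apply: eq_bigr => F FG; have FS : F \in S by move: FG; rewrite inE => /andP[].
by apply: mobE => //; exact: below_lt.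
Qed.

Lemma coefsP v : is_expansion v (coefs v).
Proof. exact: xgetPex (expansion_exists v). Qed.

End OrderedSystem.

(* Main.v *)
Require Import Defs.
From mathcomp Require Import boolp classical_sets reals.
From mathcomp Require Import all_boot all_order all_algebra.
From mathcomp Require Import lra.

Set Implicit Arguments.
Unset Strict Implicit.
Unset Printing Implicit Defensive.

Import Order.TTheory GRing.Theory Num.Theory.

Local Open Scope ring_scope.

(** A greedy packing [y], which does not depend on [v], is built by induction on
    a set X of points: take the member F of X of least index, a point p of F at
    which f is least, give F the weight f p, replace f by f - f p on F and
    continue in X minus p. Its optimality is certified by a cover x, defined in
    reverse order: x p is chosen so that x(F) = v(F). The invariant is that every
    point of positive weight lies in a tight member, and uncrossing tight members
    shows that x p >= 0 and that x still covers every member of X.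
    This works for v and for all simple functions, so the greedy value is the
    integral of v by linearity and the packing maximum by weak duality. *)

Section Greedy.
Variables (R : realType) (N : finType) (S : ordered_system N).
Variable e : seq {set N}.
Hypothesis indexing_e : is_indexing S e.
Hypothesis intersection_S : intersection_system S.
Implicit Types (F G H J K L M T X Y : {set N}) (v y : {set N} -> R).
Implicit Types (f x : N -> R) (i p : N).

Local Notation "F ⪯ G" := (sys_le S F G) (at level 70).

(** * Members inside a set of points and the first among them *)

Lemma membersP X F :
  reflect (F \in (S : {set {set N}}) /\ F \subset X) (F \in members S X).
Proof. by rewrite inE; apply: andP. Qed.

Lemma members_sub X Y F : X \subset Y -> F \in members S X -> F \in members S Y.
Proof.
by move=> XY /membersP[FS FX]; apply/membersP; split=> //; apply: subset_trans XY.
Qed.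

Lemma members_setU X F G J : F \in members S X -> G \in members S X ->
  J \in members S (F :|: G) -> J \in members S X.
Proof.
by move=> /membersP[_ FX] /membersP[_ GX]; apply: members_sub; rewrite subUset FX.
Qed.

(** Larger members come first, so a member above [F] cannot come after it. This is how a join is
    identified with a member of least index. *)
Lemma sys_le_index_eq F J : F \in S -> J \in S -> F ⪯ J ->
  (index F e <= index J e)%N -> J = F.
Proof.
case: indexing_e => _ memS le_index FS JS FJ iFJ.
apply: (@index_inj _ J e); rewrite ?inE ?memS //.
by apply/eqP; rewrite eqn_leq iFJ le_index.
Qed.

Lemma consecutive_mem F G H i : F \in S -> G \in S -> H \in S ->
  F ⪯ G -> G ⪯ H -> i \in F -> i \in H -> i \in G.
Proof.
case: intersection_S => cons _ FS GS HS FG GH iF iH.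
by apply: (subsetP (cons F G H FS GS HS FG GH)); rewrite inE iF.
Qed.

Definition first_member X F :=
  F \in members S X /\ forall G, G \in members S X -> (index F e <= index G e)%N.

Lemma first_memberP X F : first_member X F -> F \in S /\ F \subset X.
Proof. by case=> /membersP. Qed.

(** The join of [F] and [G] from [IS0] stays inside [X] and lies above [F], so by minimality of the
    index it is [F] itself. *)
Lemma first_member_ge X F G : first_member X F -> G \in members S X ->
  F :&: G != set0 -> G ⪯ F.
Proof.
case=> FX minF GX FG; have [FS _] := membersP _ _ FX.
have [GS _] := membersP _ _ GX.
case: intersection_S => _ /(_ F FS)[/(_ G GS FG)[J [JU FJ GJ]] _].
have JX := members_setU FX GX JU; have [JS _] := membersP _ _ JX.
by rewrite -(sys_le_index_eq FS JS FJ (minF _ JX)).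
Qed.

(** Same argument, with the join of [F] and [J] that [IS1] provides above [G]. *)
Lemma first_member_directed X F G J : first_member X F ->
  G \in members S X -> J \in members S X -> G ⪯ F -> G ⪯ J -> J ⪯ F.
Proof.
case=> FX minF GX JX GF GJ; have [FS _] := membersP _ _ FX.
have [GS _] := membersP _ _ GX; have [JS _] := membersP _ _ JX.
case: intersection_S => _ /(_ G GS)[_ /(_ F J FS JS GF GJ)].
move=> [K [_ [KU _ _ _ [FK JK]]]].
have KX := members_setU FX JX KU; have [KS _] := membersP _ _ KX.
by rewrite -(sys_le_index_eq FS KS FK (minF _ KX)).
Qed.

Lemma first_member_co_intersecting X F G H : first_member X F ->
  G \in members S X -> H \in members S X ->
  F :&: G != set0 -> F :&: H != set0 -> co_intersecting S e G H.
Proof.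
move=> FX GX HX FG FH; exists F; split=> //; first by case/first_memberP: FX.
by rewrite leq_min; case: FX => _ minF; rewrite !minF.
Qed.

                                                                          
                                                            
(** A weakening of [supermodular] that simple functions satisfy too: [IS1] gives meets and joins for
    pairs above a common member, and [simple_fun S R F] is positive exactly on the members above
    [F]. The join is a genuine member because it lies above non-empty ones, while the meet may be
    empty. *)
Definition supermodular_on_support v :=
  forall F G, F \in S -> G \in S -> 0 < v F -> 0 < v G ->
    co_intersecting S e F G ->
    exists M J,
      [/\ M \in members0 S (F :|: G), J \in members S (F :|: G),
          sys_le0 S M F /\ sys_le0 S M G, F ⪯ J /\ G ⪯ J &
          v F + v G <= val0 v M + v J].

Lemma supermodular_supermodular_on_support v :
  supermodular S e v -> supermodular_on_support v.
Proof.
move=> sm F G FS GS _ _ /(sm F G FS GS)[M [J [MU JU leM [FJ GJ] le_v]]].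
have F0 : F == set0 = false.
  by apply: contraTF FS => /eqP->; apply: family_set0.
have G0 : G == set0 = false.
  by apply: contraTF GS => /eqP->; apply: family_set0.
move: FJ GJ; rewrite /sys_le0 F0 G0 /= => /and3P[_ JS FJ] /and3P[_ _ GJ].
have J0 : J == set0 = false.
  by apply: contraTF JS => /eqP->; apply: family_set0.
exists M, J; split=> //; first by move: JU; rewrite inE inE J0.
by move: le_v; rewrite {2}/val0 J0.
Qed.

Lemma simple_fun_ge0 F G : 0 <= simple_fun S R F G.
Proof. exact: ler0n. Qed.

Lemma simple_fun_capacity F : F \in S -> capacity S (simple_fun S R F).
Proof.
move=> FS; split=> [G _|G H GS HS GH]; first exact: simple_fun_ge0.
rewrite /simple_fun; case FG: (F ⪯ G); last exact: ler0n.
by rewrite (sys_le_trans GS FS HS FG GH).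
Qed.

Lemma simple_fun_supermodular_on_support F :
  F \in S -> supermodular_on_support (simple_fun S R F).
Proof.
move=> FS G H GS HS; rewrite /simple_fun.
case FG: (F ⪯ G); rewrite ?ltxx // => _; case FH: (F ⪯ H); rewrite ?ltxx // => _ _.
case: intersection_S => _ /(_ F FS)[_ /(_ G H GS HS FG FH)].
move=> [J [M [JU MU FM [MG MH] [GJ HJ]]]].
have [JS _] := membersP _ _ JU; have [MS _] := membersP _ _ MU.
exists M, J; split=> //; first by rewrite inE MU orbT.
  by split; rewrite /sys_le0 MS ?GS ?HS ?MG ?MH orbT.
rewrite /val0 ifF; last by apply: contraTF MS => /eqP->; apply: family_set0.
by rewrite FM (sys_le_trans GS FS JS FG GJ).
Qed.

(** * Uncrossing and tight covers *)

Lemma sum_uncross x F G M J : (forall i, 0 <= x i) ->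
  F \in S -> G \in S ->
  M \in members0 S (F :|: G) -> J \in members S (F :|: G) ->
  sys_le0 S M F /\ sys_le0 S M G -> F ⪯ J /\ G ⪯ J ->
  \sum_(i in M) x i + \sum_(i in J) x i <= \sum_(i in F) x i + \sum_(i in G) x i.
Proof.
move=> x_ge0 FS GS MU /membersP[JS JU] [MF MG] [FJ GJ].
have MsubU : M \subset F :|: G.
  by move: MU; rewrite inE inE => /orP[/eqP->|/membersP[]//]; rewrite sub0set.
(* Both [F] and [G] lie between [M] and [J], so consecutiveness puts the common points of [M] and
   [J] in each. Hence no point is counted more often on the left than on the right. *)
have MJ i : i \in M -> i \in J -> (i \in F) && (i \in G).
  move=> iM iJ; have M0 : M == set0 = false.
    by apply/negbTE/set0Pn; exists i.
  move: MF MG; rewrite /sys_le0 M0 /= => /and3P[MS _ MF] /and3P[_ _ MG].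
  by rewrite (consecutive_mem MS FS JS) // (consecutive_mem MS GS JS).
rewrite ![\sum_(i in _) x i]big_mkcond -!big_split /=; apply: ler_sum => i _.
have := x_ge0 i; have := MJ i; have := subsetP MsubU i; have := subsetP JU i.
rewrite !inE.
case: (i \in M); case: (i \in J); case: (i \in F); case: (i \in G) => //=
  subJ subM subMJ xi; by [lra | have := subJ isT | have := subM isT
    | have := subMJ isT isT].
Qed.

Definition tight_cover v X x :=
  [/\ forall i, 0 <= x i,
      forall i, i \notin X -> x i = 0,
      forall G, G \in members S X -> v G <= \sum_(i in G) x i &
      forall i, 0 < x i ->
        exists2 H, H \in members S X & i \in H /\ \sum_(j in H) x j = v H].

(** * Extending a tight cover from [X :\ p] to [X] *)

Section Extension.
Variables (v : {set N} -> R) (X F : {set N}) (p : N) (x : N -> R).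
Hypothesis capacity_v : capacity S v.
Hypothesis supermodular_v : supermodular_on_support v.
Hypothesis firstF : first_member X F.
Hypothesis pF : p \in F.
Hypothesis cover_x : tight_cover v (X :\ p) x.

Let x_ge0 : forall i, 0 <= x i. Proof. by case: cover_x. Qed.

Let FS : F \in S. Proof. by case/first_memberP: firstF. Qed.

Let XpX G : G \in members S (X :\ p) -> G \in members S X.
Proof. exact/members_sub/subsetDl. Qed.

Let xp0 : x p = 0.
Proof. by case: cover_x => _ -> //; rewrite !inE eqxx. Qed.

(** Positivity gives access to [supermodular_on_support]; meeting [F] puts these members below [F]
    and makes any two of them co-intersecting. *)
Let tight H :=
  [&& H \in members S (X :\ p), \sum_(j in H) x j == v H, 0 < v H
    & F :&: H != set0].

Let tightP i : i \in F -> 0 < x i -> exists2 H, tight H & i \in H.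
Proof.
move=> iF xi; case: cover_x => _ _ _ /(_ i xi)[H HX [iH tH]]; exists H => //.
rewrite /tight HX tH eqxx /=; apply/andP; split; last first.
  by apply/set0Pn; exists i; rewrite inE iF.
rewrite -tH (bigD1 i) //=; apply: ltr_pwDl => //.
by apply: sumr_ge0.
Qed.

(** Uncrossing: [x(M) + x(J) <= x(H) + x(L) = v(H) + v(L) <= v(M) + v(J)], and [x] covers both [M]
    and [J], so equality holds throughout. *)
Let tight_join H L : tight H -> tight L -> exists2 J, tight J & H ⪯ J /\ L ⪯ J.
Proof.
move=> /and4P[HX /eqP tH vH FH] /and4P[LX /eqP tL vL FL].
have [HS _] := membersP _ _ HX; have [LS _] := membersP _ _ LX.
have co := first_member_co_intersecting firstF (XpX HX) (XpX LX) FH FL.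
have [M [J [MU JU leM leJ le_v]]] := supermodular_v HS LS vH vL co.
have JX := members_setU HX LX JU; have [JS _] := membersP _ _ JX.
have unc := sum_uncross x_ge0 HS LS MU JU leM leJ.
exists J => //; case: leJ => HJ LJ; case: cover_x => _ _ cov _.
have vM : val0 v M <= \sum_(i in M) x i.
  rewrite /val0; case: eqP => [->|/eqP M0]; first by rewrite big_set0.
  move: MU; rewrite inE inE (negbTE M0) /= => MU.
  exact: cov (members_setU HX LX MU).
have vJ := cov _ JX.
apply/and4P; split=> //; first by apply/eqP; lra.
  by apply: lt_le_trans vH _; case: capacity_v => _; apply.
(* Since [H ⪯ J ⪯ F], consecutiveness keeps the points of [F :&: H] in [J], so [J] meets [F]. *)
have HF := first_member_ge firstF (XpX HX) FH.
have JF := first_member_directed firstF (XpX HX) (XpX JX) HF HJ.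
have [i] := set0Pn _ FH; rewrite inE => /andP[iF iH].
by apply/set0Pn; exists i; rewrite inE iF (consecutive_mem HS JS FS).
Qed.

Let tight_support G : G \in S -> G ⪯ F -> (forall H, tight H -> H ⪯ G) ->
  forall i, i \in F -> 0 < x i -> i \in G.
Proof.
move=> GS GF topG i iF xi; have [H tH iH] := tightP iF xi.
have [/membersP[HS _] _ _ _] := and4P tH.
exact: (consecutive_mem HS GS FS (topG _ tH) GF).
Qed.

Let sum_support G : (forall i, i \in F -> 0 < x i -> i \in G) ->
  \sum_(i in F) x i <= \sum_(i in G) x i.
Proof.
move=> suppG; rewrite ![\sum_(i in _) x i]big_mkcond; apply: ler_sum => i _.
have := suppG i; have := x_ge0 i; rewrite le0r => /orP[/eqP->|xi].
  by case: (i \in F); case: (i \in G).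
move/(_ _ xi); case: (i \in F) => [->//|_].
by case: (i \in G) => //; exact: ltW.
Qed.

                                                                             
(** This makes the new value at [p] nonnegative. Without tight members [x] vanishes on [F].
    Otherwise the tight member [T] of least index absorbs its joins, so it is above all others and
    contains every point of [F] of positive weight: [x(F) <= x(T) = v(T) <= v(F)]. *)
Let sum_first_le : \sum_(i in F) x i <= v F.
Proof.
have [/existsP[T0 tT0]|/existsPn noT] := boolP [exists T, tight T]; last first.
  rewrite big1; first by case: capacity_v => + _; apply.
  move=> i iF; apply/eqP; rewrite eq_le x_ge0 andbT leNgt; apply/negP => xi.
  by have [H tH _] := tightP iF xi; move: (noT H); rewrite tH.
have [T tT minT] := arg_minnP (fun T => index T e) tT0.
have [TX /eqP xT vT FT] := and4P tT; have [TS _] := membersP _ _ TX.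
have TF := first_member_ge firstF (XpX TX) FT.
apply: (@le_trans _ _ (v T)); last by case: capacity_v => _; apply.
rewrite -xT; apply: sum_support; apply: tight_support => // L tL.
have [J tJ [TJ LJ]] := tight_join tT tL.
have [/membersP[JS _] _ _ _] := and4P tJ.
by rewrite -(sys_le_index_eq TS JS TJ (minT _ tJ)).
Qed.

Definition extend_cover i : R :=
  if i == p then v F - \sum_(j in F) x j else x i.

Let sum_extend G : \sum_(i in G) extend_cover i =
  \sum_(i in G) x i + (p \in G)%:R * (v F - \sum_(j in F) x j).
Proof.
have [pG|pG] := boolP (p \in G).
  rewrite (bigD1 p) //= [in RHS](bigD1 p) //= {1}/extend_cover eqxx xp0.
  rewrite (eq_bigr x); last by move=> i /andP[_ /negbTE ip]; rewrite /extend_cover ip.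
  by rewrite add0r mul1r addrC.
rewrite mul0r addr0; apply: eq_bigr => i iG; rewrite /extend_cover ifF //.
by apply: contraNF pG => /eqP <-.
Qed.

Let extend_ge0 i : 0 <= extend_cover i.
Proof. by rewrite /extend_cover; case: eqP => // _; rewrite subr_ge0. Qed.

Lemma sum_extend_cover : \sum_(i in F) extend_cover i = v F.
Proof. by rewrite sum_extend pF mul1r addrC subrK. Qed.

Let sum_extend_notin G : p \notin G ->
  \sum_(i in G) extend_cover i = \sum_(i in G) x i.
Proof. by move=> /negbTE pG; rewrite sum_extend pG mul0r addr0. Qed.

Let members_setD1 G : p \notin G -> G \in members S X ->
  G \in members S (X :\ p).
Proof.
by move=> pG /membersP[GS GX]; apply/membersP; rewrite subsetD1 GX pG.
Qed.

Let members_notin G : G \in members S (X :\ p) -> p \notin G.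
Proof. by move=> /membersP[_]; rewrite subsetD1 => /andP[]. Qed.

                                                                             
                                                                                
                                                                        
(** Induction on the index, the case of interest being [p \in G]. If every tight member is below
    [G], then [G] contains all positive points of [F], and [v(G) <= v(F)] suffices. Otherwise [G] is
    uncrossed with a tight [H] not below it: the join is covered by induction and the meet by the
    old cover. *)
Let extend_covers G : G \in members S X -> v G <= \sum_(i in G) extend_cover i.
Proof.
have [n] := ubnP (index G e); elim: n G => // n IH G ltGn GX.
have [GS _] := membersP _ _ GX; case: cover_x => _ _ cov _.
have [pG|pG] := boolP (p \in G); last first.
  by rewrite sum_extend_notin // cov // members_setD1.
have FG : F :&: G != set0 by apply/set0Pn; exists p; rewrite inE pF.
have GF := first_member_ge firstF GX FG.
have [vG|] := ltP 0 (v G); last first.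
  by move=> /le_trans; apply; apply: sumr_ge0 => i _.
have [/existsP[H /andP[tH HG]]|/existsPn topG] :=
    boolP [exists H, tight H && ~~ (H ⪯ G)]; last first.
  apply: (@le_trans _ _ (v F)); first by case: capacity_v => _; apply.
  have : \sum_(i in F) x i <= \sum_(i in G) x i.
    apply/sum_support/tight_support => // H tH.
    by move: (topG H); rewrite tH negbK.
  by rewrite sum_extend pG mul1r; lra.
have [HX /eqP xH vH FH] := and4P tH; have [HS _] := membersP _ _ HX.
have co := first_member_co_intersecting firstF (XpX HX) GX FH FG.
have [M [J [MU JU leM leJ le_v]]] := supermodular_v HS GS vH vG co.
have JX := members_setU (XpX HX) GX JU; have [JS _] := membersP _ _ JX.
have unc := sum_uncross extend_ge0 HS GS MU JU leM leJ.
(* [J] differs from [G] because [H] is below [J] but not below [G], so [J] comes strictly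
   earlier. *)
case: leJ => HJ GJ; have JG : (index J e < index G e)%N.
  rewrite ltnNge; apply: contra HG => iGJ.
  by rewrite -(sys_le_index_eq GS JS GJ iGJ).
have vJ := IH J (leq_trans JG ltGn) JX.
have HF := first_member_ge firstF (XpX HX) FH.
have pH := members_notin HX.
have vM : val0 v M <= \sum_(i in M) extend_cover i.
  rewrite /val0; case: eqP => [->|/eqP M0]; first by rewrite big_set0.
  move: MU; rewrite inE inE (negbTE M0) /= => MU.
  have MX := members_setU (XpX HX) GX MU; have [MS _] := membersP _ _ MX.
  have MH : M ⪯ H.
    by case: leM; rewrite /sys_le0 (negbTE M0) /= => /and3P[].
  (* As [M ⪯ H ⪯ F] and [p] lies in [F], having [p] in [M] would put it in [H]. *)
  have pM : p \notin M.
    by apply: contra pH => pM; rewrite (consecutive_mem MS HS FS).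
  by rewrite sum_extend_notin // cov // members_setD1.
by rewrite (sum_extend_notin pH) in unc; lra.
Qed.

(** [F] is the tight member through [p]; the earlier tight members avoid [p] and keep their sums. *)
Lemma extend_tight_cover : tight_cover v X extend_cover.
Proof.
have [_ FX] := first_memberP firstF; case: cover_x => _ supp _ tig.
split=> // [i iX|i].
  rewrite /extend_cover ifF; first by rewrite supp // inE (negbTE iX) andbF.
  by apply: contraNF iX => /eqP->; apply: (subsetP FX).
have [->|ip] := eqVneq i p.
  by move=> _; exists F; [case: firstF | rewrite sum_extend_cover].
rewrite {1}/extend_cover (negbTE ip) => /tig[H HX [iH tH]].
by exists H; [exact: XpX | rewrite sum_extend_notin ?members_notin].
Qed.

End Extension.

(** * The greedy packing and its dual certificates *)

Definition greedy_for X f y :=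
  [/\ forall F, 0 <= y F,
      forall i, \sum_(F in S) y F * (i \in F)%:R <= f i &
      forall v, capacity S v -> supermodular_on_support v ->
        exists2 x, tight_cover v X x &
          \sum_i f i * x i = \sum_(F in S) y F * v F].

(** In [greedy_for] the function [v] is quantified after [y]: one packing serves all such [v] at
    once, and only the cover depends on [v]. *)
Lemma greedy_exists X f : (forall i, 0 <= f i) -> exists y, greedy_for X f y.
Proof.
have [n] := ubnP #|X|; elim: n X f => // n IH X f ltXn f_ge0.
have [memX0|[F0 F0X]] := set_0Vmem (members S X).
  exists (fun=> 0); split=> // [i|v _ _].
    by rewrite big1 // => F _; rewrite mul0r.
  exists (fun=> 0); last by rewrite !big1 // => ? _; rewrite ?mul0r ?mulr0.
  by split=> // [G|i]; rewrite ?memX0 ?inE ?ltxx.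
have [F FX minF] := arg_minnP (fun F => index F e) F0X.
have firstF : first_member X F by [].
have [FS FsubX] := first_memberP firstF.
have [p0 p0F] : exists p, p \in F.
  by apply/set0Pn; apply: contraTneq FS => ->; exact: family_set0.
have [p pF minp] : exists2 p, p \in F & forall i, i \in F -> f p <= f i.
  by have [p pF minp] := arg_minP f p0F; exists p.
have pX : p \in X := subsetP FsubX _ pF.
(* The residual weight is nonnegative by the choice of [p] and vanishes at [p]. *)
pose c i := f i - f p * (i \in F)%:R.
have [||y [y_ge0 y_le dual_y]] := IH (X :\ p) c.
- by move: ltXn; rewrite (cardsD1 p X) pX.
- move=> i; rewrite /c; case iF: (i \in F); last by rewrite mulr0 subr0.
  by rewrite mulr1 subr_ge0 minp.
have sum_y a : \sum_(G in S) (y G + f p * (G == F)%:R) * a G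
    = \sum_(G in S) y G * a G + f p * a F.
  under eq_bigr do rewrite mulrDl.
  rewrite big_split /=; congr (_ + _).
  rewrite (bigD1 F) //= eqxx mulr1 big1 ?addr0 // => G /andP[_ /negbTE->].
  by rewrite mulr0 mul0r.
exists (fun G => y G + f p * (G == F)%:R); split=> [G|i|v cap_v sm_v].
- by rewrite addr_ge0 // mulr_ge0.
- by rewrite (sum_y (fun G => (i \in G)%:R)) -lerBrDr.
have [x cov_x val_x] := dual_y v cap_v sm_v.
exists (extend_cover v F p x); first exact: (extend_tight_cover cap_v sm_v firstF pF).
(* The packing gains [f p * v F], which is [f p] times the extended cover of [F]. Changing the cover
   at [p] does not affect its pairing with [c], as [c p = 0]. *)
rewrite sum_y -val_x -[X in f p * X](sum_extend_cover pF cov_x).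
rewrite [\sum_(i in F) _]big_mkcond mulr_sumr -big_split /=.
apply: eq_bigr => i _; rewrite /c /extend_cover.
have [->|ip] := eqVneq i p.
  by rewrite pF mulr1 subrr mul0r add0r.
by case: (i \in F); rewrite ?mulr1 ?mulr0 ?subr0 ?addr0 // mulrBl subrK.
Qed.

(** * Weak duality and the integral as greedy value *)

Lemma weak_duality v f x y : (forall F, F \in S -> 0 <= y F) ->
  (forall i, \sum_(F in S) y F * (i \in F)%:R <= f i) ->
  (forall i, 0 <= x i) ->
  (forall G, G \in S -> v G <= \sum_(i in G) x i) ->
  \sum_(F in S) y F * v F <= \sum_i f i * x i.
Proof.
move=> y_ge0 y_le x_ge0 x_cov.
apply: (@le_trans _ _ (\sum_(F in S) y F * \sum_(i in F) x i)).
  by apply: ler_sum => F FS; rewrite ler_wpM2l ?y_ge0 ?x_cov.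
under eq_bigr do rewrite big_mkcond mulr_sumr.
rewrite exchange_big /=; apply: ler_sum => i _.
rewrite (eq_bigr (fun F => y F * (i \in F)%:R * x i)).
  by rewrite -mulr_suml ler_wpM2r.
by move=> F _; case: (i \in F); rewrite ?mulr1 ?mulr0 ?mul0r.
Qed.

Lemma belief_integralE v f r : is_min (covering_values S v f) r ->
  belief_integral S v f = r.
Proof.
move=> [vr lbr]; rewrite /belief_integral.
have [/= vs lbs] : is_min (covering_values S v f)
    (xget 0 [set r | is_min (covering_values S v f) r]%classic).
  exact: (@xgetPex _ _ [set r | is_min (covering_values S v f) r]%classic)
    (ex_intro _ r (conj vr lbr)).
by apply/eqP; rewrite eq_le lbs // lbr.
Qed.

Lemma tight_cover_setT v x : tight_cover v [set: N] x ->
  (forall i, 0 <= x i) /\ (forall G, G \in S -> v G <= \sum_(i in G) x i).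
Proof.
by case=> x_ge0 _ cov _; split=> // G GS; apply/cov/membersP; rewrite subsetT.
Qed.

                                                                            
                                                                 
(** The same [y] is optimal for every simple function, so combining their optimal covers with the
    coefficients [b] gives a cover for [w] whose value matches the packing. The predicate [P] allows
    both [pos_part] and [neg_part]. *)
Lemma belief_integral_greedy f y w (b : {set N} -> R) (P : pred {set N}) :
  greedy_for [set: N] f y -> (forall F, P F -> 0 <= b F) ->
  (forall G, w G = \sum_(F in S | P F) b F * simple_fun S R F G) ->
  belief_integral S w f = \sum_(F in S) y F * w F.
Proof.
move=> [y_ge0 y_le dual_y] b_ge0 wE.
(* Membership sits under the existential so that [choice] applies to all sets; outside the family
   the zero cover is a dummy. *)
have dualF F : exists x : N -> R, F \in S ->
    [/\ forall i, 0 <= x i,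
        forall G, G \in S -> simple_fun S R F G <= \sum_(i in G) x i &
        \sum_i f i * x i = \sum_(G in S) y G * simple_fun S R F G].
  have [FS|nFS] := boolP (F \in (S : {set {set N}})); last by exists (fun=> 0).
  have [x /tight_cover_setT[x_ge0 x_cov] x_val] := dual_y _
    (simple_fun_capacity FS) (simple_fun_supermodular_on_support FS).
  by exists x.
have {dualF}[z zP] := choice dualF.
pose x i := \sum_(F in S | P F) b F * z F i.
have x_ge0 i : 0 <= x i.
  by apply: sumr_ge0 => F /andP[FS PF]; rewrite mulr_ge0 ?b_ge0 //; case: (zP F FS).
have x_cov G : G \in S -> w G <= \sum_(i in G) x i.
  move=> GS; rewrite wE exchange_big /=; apply: ler_sum => F /andP[FS PF].
  by rewrite -mulr_sumr ler_wpM2l ?b_ge0 //; case: (zP F FS) => _ + _; apply.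
apply: belief_integralE; split=> [|_ [x' [x'_ge0 x'_cov ->]]]; last first.
  exact: weak_duality.
exists x; split=> //; under [RHS]eq_bigr do rewrite mulr_sumr.
rewrite [RHS]exchange_big /=; under eq_bigr do rewrite wE mulr_sumr.
rewrite exchange_big /=; apply: eq_bigr => F /andP[FS _].
under eq_bigr do rewrite mulrCA; under [RHS]eq_bigr do rewrite mulrCA.
by rewrite -!mulr_sumr; case: (zP F FS) => _ _ ->.
Qed.

Lemma pos_part_sub_neg_part v G : G \in S ->
  pos_part S v G - neg_part S v G = v G.
Proof.
move=> GS; rewrite (coefsP v GS) /pos_part /neg_part -sumrN !big_mkcondr.
rewrite -big_split /=; apply: eq_bigr => F _.
rewrite mulNr opprK.
(* A zero coefficient occurs in both parts but contributes nothing. *)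
by case: (ltgtP 0 (coefs S v F)) => [|| <-]; rewrite ?mul0r ?addr0 ?add0r.
Qed.

Lemma integral_greedy v f y : greedy_for [set: N] f y ->
  integral S v f = \sum_(F in S) y F * v F.
Proof.
move=> gy; rewrite /integral.
rewrite (@belief_integral_greedy f y _ (coefs S v) (fun F => 0 <= coefs S v F)) //.
rewrite (@belief_integral_greedy f y _ (fun F => - coefs S v F)
  (fun F => coefs S v F <= 0)) //; last by move=> F; rewrite oppr_ge0.
rewrite -sumrB; apply: eq_bigr => F FS.
by rewrite -mulrBr pos_part_sub_neg_part.
Qed.

(** The greedy packing attains the integral, and the tight cover for [v] of equal value bounds every
    other packing. *)
Lemma integral_is_max v f : capacity S v -> supermodular S e v ->
  (forall i, 0 <= f i) -> is_max (packing_values S v f) (integral S v f).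
Proof.
move=> cap_v sm_v f_ge0; have [y gy] := greedy_exists [set: N] f_ge0.
rewrite (integral_greedy v gy); case: gy => y_ge0 y_le dual_y.
have [x /tight_cover_setT[x_ge0 x_cov] x_val] :=
  dual_y v cap_v (supermodular_supermodular_on_support sm_v).
split=> [|_ [y' [y'_ge0 y'_le ->]]]; first by exists y.
by rewrite -x_val; exact: weak_duality.
Qed.

End Greedy.

(** * Scaling and adding packings *)

Section PackingValues.
Variables (R : realType) (N : finType) (S : ordered_system N).
Variable v : {set N} -> R.
Implicit Types (f g : N -> R).

Lemma packing_values_scale c f r : 0 <= c -> packing_values S v f r ->
  packing_values S v (fun i => c * f i) (c * r).
Proof.
move=> c_ge0 [y [y_ge0 y_le ->]]; exists (fun F => c * y F); split=> [F FS|i|].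
- by rewrite mulr_ge0 ?y_ge0.
- by under eq_bigr do rewrite -mulrA; rewrite -mulr_sumr ler_wpM2l.
- by rewrite mulr_sumr; apply: eq_bigr => F _; rewrite mulrA.
Qed.

Lemma packing_values_add f g r s :
  packing_values S v f r -> packing_values S v g s ->
  packing_values S v (fun i => f i + g i) (r + s).
Proof.
move=> [y [y_ge0 y_le ->]] [z [z_ge0 z_le ->]].
exists (fun F => y F + z F); split=> [F FS|i|].
- by rewrite addr_ge0 ?y_ge0 ?z_ge0.
- by under eq_bigr do rewrite mulrDl; rewrite big_split lerD.
- by under [RHS]eq_bigr do rewrite mulrDl; rewrite big_split.
Qed.

Lemma packing_values_scale_max c f r s : 0 < c ->
  is_max (packing_values S v f) r ->
  is_max (packing_values S v (fun i => c * f i)) s -> s = c * r.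
Proof.
move=> c_gt0 [fr ubr] [fs ubs]; apply/eqP; rewrite eq_le; apply/andP; split.
  rewrite -ler_pdivrMl //; apply: ubr.
  have -> : f = (fun i => c^-1 * (c * f i)) by apply: funext => i; rewrite mulKf ?gt_eqF.
  by apply: packing_values_scale => //; rewrite invr_ge0 ltW.
by apply: ubs; apply: packing_values_scale => //; exact: ltW.
Qed.

(** Every member has a point, and the constraint there forces its weight to be zero. *)
Lemma packing_values_zero_max f r : (forall i, f i = 0) ->
  is_max (packing_values S v f) r -> r = 0.
Proof.
move=> f0 [[y [y_ge0 y_le ->]] _]; rewrite big1 // => F FS.
have [i iF] : exists i, i \in F.
  by apply/set0Pn; apply: contraTneq FS => ->; exact: family_set0.
have := y_le i; rewrite f0 (bigD1 F) //= iF mulr1 => le0.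
have rest : 0 <= \sum_(G in S | G != F) y G * (i \in G)%:R.
  by apply: sumr_ge0 => G /andP[GS _]; rewrite mulr_ge0 ?y_ge0.
have yF := y_ge0 F FS.
by rewrite (_ : y F = 0) ?mul0r //; lra.
Qed.

End PackingValues.

Theorem theorem4 (R : realType) (N : finType) (S : ordered_system N)
    (e : seq {set N}) (v : {set N} -> R) :
  is_indexing S e -> intersection_system S ->
  capacity S v -> supermodular S e v ->
  (forall f : N -> R, (forall i, 0 <= f i) ->
     is_max (packing_values S v f) (integral S v f)) /\
  (forall (c : R) (f : N -> R), 0 <= c -> (forall i, 0 <= f i) ->
     integral S v (fun i => c * f i) = c * integral S v f) /\
  (forall f g : N -> R, (forall i, 0 <= f i) -> (forall i, 0 <= g i) ->
     integral S v f + integral S v g <= integral S v (fun i => f i + g i)).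
Proof.
move=> ind_e is_S cap_v sm_v.
have max_v f : (forall i, 0 <= f i) ->
    is_max (packing_values S v f) (integral S v f).
  exact: (integral_is_max ind_e is_S cap_v sm_v).
split=> //; split=> [c f c_ge0 f_ge0|f g f_ge0 g_ge0].
  have cf_ge0 i : 0 <= c * f i by rewrite mulr_ge0.
  (* The scaling argument divides by [c], so [c = 0] is treated apart. *)
  move: c_ge0; rewrite le0r => /orP[/eqP c0|c_gt0].
    rewrite c0 mul0r; apply: (packing_values_zero_max (S := S) (v := v)) (max_v _ _).
      by move=> i; rewrite mul0r.
    by move=> i; rewrite mul0r.
  exact: packing_values_scale_max c_gt0 (max_v _ f_ge0) (max_v _ cf_ge0).
have fg_ge0 i : 0 <= f i + g i by rewrite addr_ge0.
have [_ ub] := max_v _ fg_ge0; apply: ub.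
by apply: packing_values_add; [case: (max_v _ f_ge0)|case: (max_v _ g_ge0)].
Qed.
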